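(* Let $f:\mathbb{R}^d\to\mathbb{R}$ be continuously differentiable and convex, with $\nabla f$ $L$-Lipschitz continuous for a constant $L>0$. Run the BFGS method with Armijo-Wolfe line search (as described in the context) on $f$ from an arbitrary $x_0\in\mathbb{R}^d$, with a symmetric positive definite $B_0$ and parameters $0<c_1<c_2<1$. Let $g_i:=\nabla f(x_i)$ and $$r_i:=\frac{L(g_i^\top s_i)^2}{\|g_i\|^2\,y_i^\top s_i}.$$ Then for every $k\ge1$ before termination, $$\sum_{i=0}^{k-1}\log r_i\ \ge\ -\Psi_L(B_0)+\sum_{i=0}^{k-1}\left(1-\frac{\|y_i\|^2}{L\,y_i^\top s_i}\right)\ \ge\ -\Psi_L(B_0).$$ In particular, $\prod_{i=0}^{k-1} r_i\ge e^{-\Psi_L(B_0)}$.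
   Context: $\|\cdot\|$ is the Euclidean norm on $\mathbb{R}^d$. BFGS method with Armijo-Wolfe line search. Input: $x_0\in\mathbb{R}^d$, a symmetric positive definite matrix $B_0\in\mathbb{R}^{d\times d}$, and parameters $0<c_1<c_2<1$. For $k=0,1,2,\dots$: - if $\|\nabla f(x_k)\|=0$, terminate; - set $p_k=-B_k^{-1}\nabla f(x_k)$; - choose any step size $\alpha_k>0$ satisfying both the Armijo condition $f(x_k+\alpha_kp_k)\le f(x_k)+c_1\alpha_k\nabla f(x_k)^\top p_k$ and the Wolfe condition $\nabla f(x_k+\alpha_kp_k)^\top p_k\ge c_2\nabla f(x_k)^\top p_k$; - set $x_{k+1}=x_k+\alpha_kp_k$, $s_k=x_{k+1}-x_k$, $y_k=\nabla f(x_{k+1})-\nabla f(x_k)$, and $$B_{k+1}=B_k-\frac{B_ks_ks_k^\top B_k}{s_k^\top B_ks_k}+\frac{y_ky_k^\top}{y_k^\top s_k}.$$ The step sizes are arbitrary subject to the two line-search conditions. An index $k$ is ''before termination'' if $\nabla f(x_i)\ne0$ for all $0\le i\le k$. Potential function: for symmetric positive definite $B\in\mathbb{R}^{d\times d}$, $$\Psi_L(B):=\operatorname{tr}(B/L)-d-\log\det(B/L).$$ *)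

(* Defs.v *)
From HB Require Import structures.
From mathcomp Require Import all_boot all_order all_algebra.
From mathcomp Require Import all_classical all_reals all_analysis.

Set Implicit Arguments.
Unset Strict Implicit.
Unset Printing Implicit Defensive.

Import Order.TTheory GRing.Theory Num.Theory.
Import numFieldNormedType.Exports.

Local Open Scope classical_set_scope.
Local Open Scope ring_scope.

(* The library norm on 'cV[R]_d is the sup norm, hence the separate Euclidean
   norm. Topology and differentiability are the same for both. *)
Definition dot (R : realType) (d : nat) (u v : 'cV[R]_d) : R :=
  (u^T *m v) ord0 ord0.

Definition enorm (R : realType) (d : nat) (u : 'cV[R]_d) : R :=
  Num.sqrt (dot u u).

Definition grad (R : realType) (d : nat) (f : 'cV[R]_d -> R) (x : 'cV[R]_d) :
  'cV[R]_d := \col_(i < d) 'D_(delta_mx i ord0) f x.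

Definition continuously_differentiable (R : realType) (d : nat)
    (f : 'cV[R]_d -> R) : Prop :=
  (forall x, differentiable f x) /\ continuous (grad f).

Definition gradient_lipschitz (R : realType) (d : nat) (L : R)
    (f : 'cV[R]_d -> R) : Prop :=
  forall x y, enorm (grad f x - grad f y) <= L * enorm (x - y).

Definition spd (R : realType) (d : nat) (B : 'M[R]_d) : Prop :=
  B^T = B /\ forall u : 'cV[R]_d, u != 0 -> 0 < dot u (B *m u).

Definition Psi (R : realType) (d : nat) (L : R) (B : 'M[R]_d) : R :=
  \tr (L^-1 *: B) - d%:R - ln (\det (L^-1 *: B)).

Definition bfgs_update (R : realType) (d : nat) (B : 'M[R]_d)
    (s y : 'cV[R]_d) : 'M[R]_d :=
  B - (dot s (B *m s))^-1 *: (B *m s *m s^T *m B)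
    + (dot y s)^-1 *: (y *m y^T).

Definition armijo (R : realType) (d : nat) (f : 'cV[R]_d -> R) (c1 : R)
    (x p : 'cV[R]_d) (alpha : R) : Prop :=
  f (x + alpha *: p) <= f x + c1 * alpha * dot (grad f x) p.

Definition wolfe (R : realType) (d : nat) (f : 'cV[R]_d -> R) (c2 : R)
    (x p : 'cV[R]_d) (alpha : R) : Prop :=
  dot (grad f (x + alpha *: p)) p >= c2 * dot (grad f x) p.

(* A relation rather than a function: the step size is any one accepted by the
   line search, and no step is taken from a stationary point. *)
Definition bfgs_step (R : realType) (d : nat) (f : 'cV[R]_d -> R) (c1 c2 : R)
    (x : 'cV[R]_d) (B : 'M[R]_d) (x' : 'cV[R]_d) (B' : 'M[R]_d) : Prop :=
  let p := - (invmx B *m grad f x) in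
  enorm (grad f x) != 0 /\
  exists alpha : R,
    [/\ 0 < alpha, armijo f c1 x p alpha, wolfe f c2 x p alpha,
        x' = x + alpha *: p &
        B' = bfgs_update B (x' - x) (grad f x' - grad f x)].

(* The first k iterations of a run; the entries of x and B beyond index k are
   unconstrained, so runs that terminate or whose line search later admits no
   step size are covered up to that point. *)
Definition bfgs_run (R : realType) (d : nat) (f : 'cV[R]_d -> R) (c1 c2 : R)
    (x0 : 'cV[R]_d) (B0 : 'M[R]_d) (k : nat)
    (x : nat -> 'cV[R]_d) (B : nat -> 'M[R]_d) : Prop :=
  [/\ x 0%N = x0, B 0%N = B0 &
      forall i, (i < k)%N -> bfgs_step f c1 c2 (x i) (B i) (x i.+1) (B i.+1)].

Definition before_termination (R : realType) (d : nat) (f : 'cV[R]_d -> R)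
    (x : nat -> 'cV[R]_d) (k : nat) : Prop :=
  forall i, (i <= k)%N -> grad f (x i) != 0.

Definition sdiff (R : realType) (d : nat) (x : nat -> 'cV[R]_d) (i : nat) :
  'cV[R]_d := x i.+1 - x i.

Definition ydiff (R : realType) (d : nat) (f : 'cV[R]_d -> R)
    (x : nat -> 'cV[R]_d) (i : nat) : 'cV[R]_d :=
  grad f (x i.+1) - grad f (x i).

Definition rratio (R : realType) (d : nat) (L : R) (f : 'cV[R]_d -> R)
    (x : nat -> 'cV[R]_d) (i : nat) : R :=
  L * dot (grad f (x i)) (sdiff x i) ^+ 2
  / (enorm (grad f (x i)) ^+ 2 * dot (ydiff f x i) (sdiff x i)).

(* Main.v *)
(* Since B_i s_i is a multiple of g_i, writing b = B_i s_i and q = s_i^T b one has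
   r_i = (L q / |b|^2) (q / y_i^T s_i). On the other hand the update multiplies
   the determinant by y_i^T s_i / q and changes the trace by
   |y_i|^2 / y_i^T s_i - |b|^2 / q, so ln t <= t - 1 at t = |b|^2 / (L q) gives
     Psi(B_{i+1}) <= Psi(B_i) + ln r_i - (1 - |y_i|^2 / (L y_i^T s_i)).
   Telescoping and Psi(B_k) >= 0 yield the first bound; the remaining sum is
   nonnegative because the gradient of f is 1/L-cocoercive (Baillon-Haddad). *)

Require Import Defs.
From mathcomp Require Import all_boot all_order all_algebra.
From mathcomp Require Import all_classical all_reals all_analysis.
From mathcomp Require Import ring lra.

Set Implicit Arguments.
Unset Strict Implicit.

Import Order.TTheory GRing.Theory Num.Theory.
Import numFieldNormedType.Exports.

Local Open Scope classical_set_scope.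
Local Open Scope ring_scope.

(** * The Euclidean inner product *)

Lemma trmx_mul_dot (R : realType) (d : nat) (u v : 'cV[R]_d) :
  u^T *m v = (dot u v)%:M.
Proof. by rewrite [LHS]mx11_scalar. Qed.

Lemma dotE (R : realType) (d : nat) (u v : 'cV[R]_d) :
  dot u v = \sum_i u i ord0 * v i ord0.
Proof. by rewrite /dot mxE; apply: eq_bigr => i _; rewrite mxE. Qed.

Lemma dotC (R : realType) (d : nat) (u v : 'cV[R]_d) : dot u v = dot v u.
Proof. by rewrite !dotE; apply: eq_bigr => i _; rewrite mulrC. Qed.

Lemma dotDr (R : realType) (d : nat) (u v w : 'cV[R]_d) :
  dot u (v + w) = dot u v + dot u w.
Proof. by rewrite /dot mulmxDr mxE. Qed.

Lemma dotZr (R : realType) (d : nat) (a : R) (u v : 'cV[R]_d) :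
  dot u (a *: v) = a * dot u v.
Proof. by rewrite /dot -scalemxAr mxE. Qed.

Lemma dotNr (R : realType) (d : nat) (u v : 'cV[R]_d) :
  dot u (- v) = - dot u v.
Proof. by rewrite /dot mulmxN mxE. Qed.

Lemma dotBr (R : realType) (d : nat) (u v w : 'cV[R]_d) :
  dot u (v - w) = dot u v - dot u w.
Proof. by rewrite dotDr dotNr. Qed.

Lemma dotDl (R : realType) (d : nat) (u v w : 'cV[R]_d) :
  dot (u + v) w = dot u w + dot v w.
Proof. by rewrite !(dotC _ w) dotDr. Qed.

Lemma dotZl (R : realType) (d : nat) (a : R) (u v : 'cV[R]_d) :
  dot (a *: u) v = a * dot u v.
Proof. by rewrite !(dotC _ v) dotZr. Qed.

Lemma dotNl (R : realType) (d : nat) (u v : 'cV[R]_d) :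
  dot (- u) v = - dot u v.
Proof. by rewrite !(dotC _ v) dotNr. Qed.

Lemma dotBl (R : realType) (d : nat) (u v w : 'cV[R]_d) :
  dot (u - v) w = dot u w - dot v w.
Proof. by rewrite dotDl dotNl. Qed.

Lemma dot0r (R : realType) (d : nat) (u : 'cV[R]_d) : dot u 0 = 0.
Proof. by rewrite /dot mulmx0 mxE. Qed.

Lemma dot_ge0 (R : realType) (d : nat) (u : 'cV[R]_d) : 0 <= dot u u.
Proof. by rewrite dotE; apply: sumr_ge0 => i _; rewrite -expr2 sqr_ge0. Qed.

Lemma sqr_enorm (R : realType) (d : nat) (u : 'cV[R]_d) :
  enorm u ^+ 2 = dot u u.
Proof. by rewrite sqr_sqrtr // dot_ge0. Qed.

Lemma dot_eq0 (R : realType) (d : nat) (u : 'cV[R]_d) :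
  (dot u u == 0) = (u == 0).
Proof.
apply/idP/eqP => [|->]; last by rewrite dot0r.
rewrite dotE psumr_eq0 => [/allP u0|i _]; last by rewrite -expr2 sqr_ge0.
apply/colP => i; apply/eqP; rewrite mxE.
by have := u0 i (mem_index_enum _); rewrite -expr2 sqrf_eq0.
Qed.

(** * Rank-one matrices, positive definiteness and the log-determinant *)

Lemma mxtrace_mul_tr (R : realType) (d : nat) (u v : 'cV[R]_d) :
  \tr (u *m v^T) = dot v u.
Proof. by rewrite mxtrace_mulC trmx_mul_dot mxtrace_scalar mulr1n. Qed.

(** Matrix determinant lemma: the bordered matrix with blocks [1], [- v^T], [u], [1] factors through
    the unit lower triangular [l] on either side, and the two complementary factors are block upper
    triangular. *)
Lemma det_rank1_update (R : realType) (d : nat) (u v : 'cV[R]_d) :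
  \det (1%:M + u *m v^T) = 1 + dot v u.
Proof.
pose l : 'M[R]_(1 + d) := block_mx 1%:M 0 u 1%:M.
have dl : \det l = 1 by rewrite det_lblock !det1 mulr1.
have lE : l *m block_mx 1%:M (- v^T) 0 (1%:M + u *m v^T) =
          block_mx 1%:M (- v^T) u 1%:M.
  rewrite mulmx_block !(mul1mx, mul0mx, mulmx1, mulmx0, addr0) mulmxN.
  by rewrite addrCA addNr addr0.
have : block_mx (1 + v^T *m u) (- v^T) 0 1%:M *m l =
       block_mx 1%:M (- v^T) u 1%:M.
  rewrite mulmx_block !(mul1mx, mul0mx, mulmx1, mulmx0, addr0, add0r).
  by rewrite mulNmx addrK.
move/(congr1 determinant); rewrite -lE !det_mulmx dl mulr1 mul1r.
rewrite !det_ublock !det1 mul1r mulr1 => <-.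
by rewrite det_mx11 trmx_mul_dot !mxE !eqxx.
Qed.

Lemma ln_le_sub1 (R : realType) (t : R) : 0 < t -> ln t <= t - 1.
Proof.
move=> t0; have := @le_ln1Dx R (t - 1).
by rewrite addrCA subrr addr0; apply; lra.
Qed.

Lemma spd_unitmx (R : realType) (d : nat) (B : 'M[R]_d) :
  spd B -> B \in unitmx.
Proof.
case=> Bt Bpos; rewrite -row_free_unit -kermx_eq0; apply/eqP/row_matrixP => i.
rewrite row0; apply/eqP; apply: contraT => k0.
have uB : row i (kermx B) *m B = 0 by apply/sub_kermxP; rewrite row_sub.
have ut : (row i (kermx B))^T != 0 by rewrite trmx_eq0.
have := Bpos _ ut; rewrite -[X in X *m _]Bt -trmx_mul uB trmx0 dot0r.
by rewrite ltxx.
Qed.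

Lemma spd_congr (R : realType) (d : nat) (E B : 'M[R]_d) :
  E \in unitmx -> spd B -> spd (E *m B *m E^T).
Proof.
move=> Eu [Bt Bpos]; split=> [|u u0]; first by rewrite !trmx_mul trmxK Bt mulmxA.
(* The quadratic form of [E *m B *m E^T] at [u] is that of [B] at [E^T *m u], which is nonzero
   because [E] is invertible. *)
rewrite /dot -!mulmxA mulmxA -[X in X *m _]trmxK trmx_mul trmxK; apply: Bpos.
apply: contra u0 => /eqP/(congr1 (mulmx (invmx E^T))).
by rewrite mulmx0 mulKmx ?unitmx_tr // => ->.
Qed.

(* Elimination of the first row and column replaces A by a block-diagonal
   matrix with the same determinant and no larger trace. *)
Lemma spd_ln_det_le (R : realType) (d : nat) (A : 'M[R]_d) :
  spd A -> 0 < \det A /\ ln (\det A) <= \tr A - d%:R.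
Proof.
elim: d A => [|d IHd] A As.
  by rewrite det_mx00 ln1 /mxtrace big_ord0 subr0 ltr01 lexx.
pose M : 'M[R]_(1 + d) := A; have Ms : spd M by [].
pose a := M 0 0; pose b := dlsubmx M; pose C := drsubmx M.
have ula : ulsubmx M = a%:M.
  by rewrite [LHS]mx11_scalar !mxE; congr (M _ _)%:M; apply/val_inj.
have urb : ursubmx M = b^T by rewrite /b trmx_dlsub (proj1 Ms).
have ME : M = block_mx a%:M b^T b C by rewrite -ula -urb submxK.
have a_gt0 : 0 < a.
  have /(proj2 Ms) : col_mx 1%:M 0 != 0 :> 'cV[R]_(1 + d).
    by rewrite col_mx_eq0 negb_and oner_neq0.
  rewrite /dot ME mul_block_col tr_col_mx mul_row_col trmx0 trmx1.
  by rewrite !(mulmx0, mul0mx, addr0) mul1mx mulmx1 mxE eqxx.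
pose E : 'M[R]_(1 + d) := block_mx 1%:M 0 (- a^-1 *: b) 1%:M.
have detE : \det E = 1 by rewrite det_lblock !det1 mulr1.
have Eu : E \in unitmx by rewrite unitmxE detE unitr1.
(* The Schur complement of the pivot [a]. Congruence by [E] makes [M] block diagonal, so [S]
   inherits positive definiteness. *)
pose S := C - a^-1 *: (b *m b^T).
have EE : E *m M *m E^T = block_mx a%:M 0 0 S.
  have ba : (- a^-1 *: b) *m a%:M = - b.
    by rewrite mul_mx_scalar scalerA mulrN mulfV ?gt_eqF // scaleN1r.
  have ab : a%:M *m (- a^-1 *: b)^T = - b^T.
    by rewrite -[LHS](trmxK _) trmx_mul trmxK tr_scalar_mx ba linearN.
  rewrite ME tr_block_mx !mulmx_block !trmx1 !trmx0.
  rewrite !(mul1mx, mul0mx, mulmx1, mulmx0, addr0, add0r) ba ab !addNr.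
  by rewrite mul0mx add0r addrC -scalemxAl scaleNr.
have := spd_congr Eu Ms; rewrite EE => -[DT Dpos].
have Ss : spd S.
  split; first by move: DT; rewrite tr_block_mx => /eq_block_mx[].
  move=> u u0; have /Dpos : col_mx 0 u != 0 :> 'cV[R]_(1 + d).
    by rewrite col_mx_eq0 negb_and u0 orbT.
  rewrite /dot mul_block_col tr_col_mx mul_row_col trmx0.
  by rewrite !(mulmx0, mul0mx, add0r).
have [detS lnS] := IHd _ Ss.
have detM : \det M = a * \det S.
  have := congr1 determinant EE.
  by rewrite !det_mulmx det_tr detE mulr1 mul1r det_ublock det_scalar1.
have trM : \tr M = a + \tr C.
  by rewrite ME mxtrace_block mxtrace_scalar mulr1n.
have trS : \tr S = \tr C - a^-1 * dot b b.
  by rewrite /S linearB linearZ /= mxtrace_mul_tr.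
(* This is the trace lost in passing from [C] to [S]. The bound for [S] and [ln a <= a - 1] then add
   up to the bound for [M]. *)
have bb : 0 <= a^-1 * dot b b by rewrite mulr_ge0 ?dot_ge0 ?invr_ge0 // ltW.
have := ln_le_sub1 a_gt0.
rewrite -[A]/M detM trM lnM ?posrE //; split; first exact: mulr_gt0.
by rewrite -natr1; lra.
Qed.

Lemma spdZ (R : realType) (d : nat) (a : R) (B : 'M[R]_d) :
  0 < a -> spd B -> spd (a *: B).
Proof.
move=> a0 [Bt Bpos]; split=> [|u u0]; first by rewrite linearZ /= Bt.
by rewrite -scalemxAl dotZr mulr_gt0 // Bpos.
Qed.

Lemma Psi_ge0 (R : realType) (d : nat) (L : R) (B : 'M[R]_d) :
  0 < L -> spd B -> 0 <= Psi L B.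
Proof.
move=> L0 Bs; have Li : 0 < L^-1 by rewrite invr_gt0.
have [_] := spd_ln_det_le (spdZ Li Bs).
by rewrite /Psi; lra.
Qed.

(** * Product form of the BFGS update *)

Lemma rank1_congr (R : realType) (d : nat) (B : 'M[R]_d) (s w : 'cV[R]_d) :
  B^T = B ->
  (1%:M + w *m s^T) *m B *m (1%:M + w *m s^T)^T =
  B + w *m (B *m s)^T + B *m s *m w^T + dot s (B *m s) *: (w *m w^T).
Proof.
move=> Bt; have -> : (1%:M + w *m s^T)^T = 1%:M + s *m w^T.
  by rewrite linearD /= trmx1 trmx_mul trmxK.
rewrite mulmxDr mulmx1 !mulmxDl mul1mx trmx_mul Bt -!mulmxA !addrA.
congr (_ + _); rewrite (mulmxA B s) (mulmxA s^T) trmx_mul_dot mul_scalar_mx.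
by rewrite -scalemxAr.
Qed.

(* Brodlie-Gourlay-Greenstadt product form: with z = sqrt(s^T B s / y^T s) y, the
   BFGS update is E B E^T for E = 1 + (z - B s) s^T / (s^T B s). *)
Lemma bfgs_update_factor (R : realType) (d : nat) (B : 'M[R]_d)
    (s y : 'cV[R]_d) :
  B^T = B -> 0 < dot s (B *m s) -> 0 < dot y s ->
  exists E : 'M[R]_d, [/\ bfgs_update B s y = E *m B *m E^T,
    \det E ^+ 2 = dot y s / dot s (B *m s) & \det E != 0].
Proof.
move=> Bt; set q := dot s (B *m s) => q0 ys0.
have [r r0 r2] : exists2 r : R, 0 < r & r ^+ 2 = q / dot y s.
  exists (Num.sqrt (q / dot y s)); first by rewrite sqrtr_gt0 divr_gt0.
  by rewrite sqr_sqrtr // ltW // divr_gt0.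
pose w : 'cV[R]_d := q^-1 *: (r *: y - B *m s).
have detE : \det (1%:M + w *m s^T) = r * dot y s / q.
  rewrite det_rank1_update dotZr dotBr dotZr -/q (dotC s); field.
  by rewrite gt_eqF.
exists (1%:M + w *m s^T); split; rewrite ?detE; last first.
- by rewrite !mulf_neq0 ?invr_eq0 ?gt_eqF.
- by rewrite !exprMn r2; field; rewrite !gt_eqF.
rewrite rank1_congr // -/q /bfgs_update -/q.
have -> : (dot y s)^-1 = q^-1 * r ^+ 2.
  by rewrite r2 mulrA mulVf ?gt_eqF // mul1r.
have -> : B *m s *m s^T *m B = (B *m s) *m (B *m s)^T.
  by rewrite trmx_mul Bt !mulmxA.
(* With [q *: w = r *: y - b], the last three terms of the congruence collapse to [q^-1] times
   [r ^+ 2 *: (y *m y^T) - b *m b^T], checked entrywise. *)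
rewrite /w; move: (B *m s) => b; apply/matrixP => i j.
do 6 rewrite ?mxE ?big_ord1; field.
by rewrite gt_eqF.
Qed.

(** * Smooth convex functions along lines, up to cocoercivity *)

Lemma derive_grad (R : realType) (d : nat) (f : 'cV[R]_d -> R)
    (x v : 'cV[R]_d) :
  differentiable f x -> 'D_v f x = dot (grad f x) v.
Proof.
move=> df; rewrite deriveE // {1}(matrix_sum_delta v) linear_sum dotE.
apply: eq_bigr => i _; rewrite big_ord1 linearZ /= mxE deriveE //.
exact: mulrC.
Qed.

Lemma is_derive_line (R : realType) (d : nat) (f : 'cV[R]_d -> R)
    (x v : 'cV[R]_d) (t : R) :
  differentiable f (x + t *: v) ->
  is_derive t 1 (fun a : R => f (x + a *: v)) (dot (grad f (x + t *: v)) v).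
Proof.
move=> df.
have quotE : (fun h : R => h^-1 *: (f (x + (h *: 1 + t) *: v) - f (x + t *: v)))
    = (fun h : R => h^-1 *: (f (h *: v + (x + t *: v)) - f (x + t *: v))).
  apply/funext => h; do 3 f_equal.
  by rewrite scalerDl [h *: 1]mulr1 addrCA.
split; first by rewrite /derivable /= quotE; exact: diff_derivable.
by rewrite -derive_grad // /derive /= quotE.
Qed.

Lemma continuous_line (R : realType) (d : nat) (f : 'cV[R]_d -> R)
    (x v : 'cV[R]_d) :
  (forall z, differentiable f z) -> continuous (fun a : R => f (x + a *: v)).
Proof.
move=> df t; apply/differentiable_continuous/derivable1_diffP.
by have [] := is_derive_line (df (x + t *: v)).
Qed.

(** Expanding [0 <= dot (u - a *: v) (u - a *: v)] bounds [2 * a * dot u v] by the two squared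
    norms, so Cauchy-Schwarz is not invoked. *)
Lemma dot_amgm (R : realType) (d : nat) (u v : 'cV[R]_d) (a : R) :
  0 < a -> enorm u <= a * enorm v -> dot u v <= a * dot v v.
Proof.
move=> a0 uv; have : dot u u <= a ^+ 2 * dot v v.
  rewrite -!sqr_enorm -exprMn ler_sqr ?nnegrE ?mulr_ge0 ?sqrtr_ge0 //.
  exact: ltW.
have := dot_ge0 (u - a *: v).
rewrite !(dotBl, dotBr, dotZl, dotZr) (dotC v u) => h1 h2.
rewrite -(ler_pM2l a0); nra.
Qed.

Lemma grad_line_le (R : realType) (d : nat) (f : 'cV[R]_d -> R) (L : R)
    (x v : 'cV[R]_d) (t : R) :
  0 < L -> gradient_lipschitz L f -> 0 < t ->
  `|dot (grad f (x + t *: v)) v - dot (grad f x) v| <= L * t * dot v v.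
Proof.
move=> L0 fL t0; have Lt : 0 < L * t by exact: mulr_gt0.
have h : enorm (grad f (x + t *: v) - grad f x) <= L * t * enorm v.
  apply: le_trans (fL _ _) _; rewrite addrC addKr.
  rewrite /enorm dotZl dotZr mulrA -expr2 sqrtrM ?sqr_ge0 // sqrtr_sqr gtr0_norm //.
  by rewrite mulrA.
have hN : enorm (- (grad f (x + t *: v) - grad f x)) <= L * t * enorm v.
  by rewrite /enorm dotNl dotNr opprK.
rewrite -dotBl ler_norml (dot_amgm Lt h) andbT lerNl -dotNl.
exact: dot_amgm hN.
Qed.

Lemma descent_lemma (R : realType) (d : nat) (f : 'cV[R]_d -> R) (L : R)
    (x v : 'cV[R]_d) :
  (forall z, differentiable f z) -> 0 < L -> gradient_lipschitz L f ->
  f (x + v) <= f x + dot (grad f x) v + L / 2 * dot v v.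
Proof.
move=> df L0 fL; set g := dot (grad f x) v; set q := L / 2 * dot v v.
(* By the Lipschitz bound along the line, [phi] has nonpositive derivative on the open unit
   interval; the mean value theorem gives [phi 1 <= phi 0], with no integral. *)
pose phi (t : R) := f (x + t *: v) - (g * t + q * (t * t)).
have dphi (t : R) : is_derive t 1 phi
    (dot (grad f (x + t *: v)) v - (g * 1 + q * (t * 1 + t * 1))).
  apply: is_deriveB; first exact: is_derive_line.
have cphi : {within `[0, 1], continuous phi}.
  apply: derivable_within_continuous => t _.
  by have [] := dphi t.
have [c c01] := MVT (@ltr01 R) (fun t _ => dphi t) cphi.
move: c01; rewrite in_itv /= => /andP[c0 c1].
rewrite /phi !scale0r scale1r addr0.
have /ler_normlP[_] := grad_line_le x v L0 fL c0.
rewrite -/g /q; lra.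
Qed.

(** Convexity bounds the chord slope over [[0, t]] by [f (x + v) - f x], while the mean value
    theorem and the Lipschitz gradient bound it below by [g - q * t]. Small [t] gives the claim. *)
Lemma convex_first_order (R : realType) (d : nat) (f : 'cV[R]_d -> R) (L : R)
    (x v : 'cV[R]_d) :
  (forall z, differentiable f z) -> 0 < L -> gradient_lipschitz L f ->
  @convex_function R 'cV[R]_d setT f ->
  f x + dot (grad f x) v <= f (x + v).
Proof.
move=> df L0 fL fc; set g := dot (grad f x) v; pose q := L * dot v v.
have q0 : 0 <= q by rewrite mulr_ge0 ?dot_ge0 // ltW.
have chord (t : R) : 0 < t -> t <= 1 ->
    f (x + t *: v) <= f x + t * (f (x + v) - f x).
  move=> t0 t1.
  have := fc (Itv01 (ltW t0) t1) (x + v) x (in_setT _) (in_setT _).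
  rewrite convRE /=.
  have -> : conv (Itv01 (ltW t0) t1) (x + v : convex_lmodType _) x = x + t *: v.
    rewrite /conv /= /unstable.onem scalerDr scalerBl scale1r.
    by rewrite addrAC addrCA subrr addr0.
  by rewrite /unstable.onem; lra.
have slope (t : R) : 0 < t -> t <= 1 -> g <= f (x + v) - f x + q * t.
  move=> t0 t1.
  have cont : {within `[0, t], continuous (fun a : R => f (x + a *: v))}.
    by apply: continuous_subspaceT => ?; exact: continuous_line.
  have [c] := MVT t0 (fun a _ => is_derive_line (df (x + a *: v))) cont.
  rewrite in_itv /= => /andP[c0 ct]; rewrite scale0r addr0 subr0 => fE.
  have /ler_normlP[] := grad_line_le x v L0 fL c0; rewrite -/g opprB => gc _.
  have := chord t t0 t1; have qc : q * c <= q * t by rewrite ler_wpM2l // ltW.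
  have : L * c * dot v v = q * c by rewrite /q mulrAC.
  move=> Lq; rewrite Lq in gc => ch.
  have : dot (grad f (x + c *: v)) v * t <= (f (x + v) - f x) * t by lra.
  rewrite ler_pM2r //; lra.
(* An explicit [t] replaces the limit at zero: for a violation [e > 0], [t = e / (e + q)] lies in
   the admissible range and makes [q * t < e], contradicting [slope]. *)
rewrite leNgt; apply/negP => lt_f; pose e := g + f x - f (x + v).
have e0 : 0 < e by rewrite /e; lra.
have eq0 : 0 < e + q by lra.
have := slope (e / (e + q)) (divr_gt0 e0 eq0).
rewrite ler_pdivrMr // mul1r lerDl => /(_ q0) h.
have : e <= q * (e / (e + q)) by rewrite /e in h *; lra.
rewrite mulrA ler_pdivlMr //; nra.
Qed.

(* Baillon-Haddad: f - <grad f x, .> is minimal at x, and a gradient step from y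
   decreases it by at least ||grad f y - grad f x||^2 / (2 L). *)
Lemma grad_cocoercive (R : realType) (d : nat) (f : 'cV[R]_d -> R) (L : R)
    (x y : 'cV[R]_d) :
  (forall z, differentiable f z) -> 0 < L -> gradient_lipschitz L f ->
  @convex_function R 'cV[R]_d setT f ->
  enorm (grad f y - grad f x) ^+ 2 <= L * dot (grad f y - grad f x) (y - x).
Proof.
move=> df L0 fL fc; rewrite sqr_enorm.
have half (a b : 'cV[R]_d) : f a + dot (grad f a) (b - a)
    + L^-1 / 2 * dot (grad f b - grad f a) (grad f b - grad f a) <= f b.
  have gw : grad f b = grad f a + (grad f b - grad f a) by rewrite addrC subrK.
  move: (grad f b - grad f a) gw => w gw.
  (* The increment leads from [a] to [b - L^-1 *: w], the gradient step from [b] for the tilted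
     function; [hi] bounds [f] at that point from above. *)
  have := convex_first_order a (b - a - L^-1 *: w) df L0 fL fc.
  rewrite addrA addrCA subrr addr0 => lo.
  have := descent_lemma b (- (L^-1 *: w)) df L0 fL => hi.
  move: lo hi; rewrite !(dotNl, dotNr, dotZl, dotZr, dotBr (grad f a)) opprK gw dotDl.
  have -> : L / 2 * (L^-1 * (L^-1 * dot w w)) = L^-1 / 2 * dot w w.
    by field; rewrite gt_eqF.
  by rewrite mulrDr; lra.
(* Adding [half] in both orders cancels the function values. *)
have := half x y; have := half y x.
have -> : dot (grad f x - grad f y) (grad f x - grad f y) =
          dot (grad f y - grad f x) (grad f y - grad f x).
  by rewrite -(opprB (grad f y)) dotNl dotNr opprK.
set w := grad f y - grad f x => h1 h2.
have : dot w (y - x) = dot (grad f y) (y - x) - dot (grad f x) (y - x).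
  by rewrite dotBl.
have : dot (grad f y) (x - y) = - dot (grad f y) (y - x).
  by rewrite -dotNr opprB.
move=> e1 e2; have : L^-1 * dot w w <= dot w (y - x) by lra.
by rewrite ler_pdivrMl.
Qed.

(** * Effect of the update on determinant, trace and potential *)

Lemma bfgs_update_spd (R : realType) (d : nat) (B : 'M[R]_d) (s y : 'cV[R]_d) :
  spd B -> 0 < dot s (B *m s) -> 0 < dot y s -> spd (bfgs_update B s y).
Proof.
move=> Bs q0 ys0; have [E [-> _ E0]] := bfgs_update_factor (proj1 Bs) q0 ys0.
by apply: spd_congr => //; rewrite unitmxE unitfE.
Qed.

Lemma det_bfgs_update (R : realType) (d : nat) (B : 'M[R]_d)
    (s y : 'cV[R]_d) :
  B^T = B -> 0 < dot s (B *m s) -> 0 < dot y s ->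
  \det (bfgs_update B s y) = dot y s / dot s (B *m s) * \det B.
Proof.
move=> Bt q0 ys0; have [E [-> <- _]] := bfgs_update_factor Bt q0 ys0.
by rewrite !det_mulmx det_tr mulrAC expr2.
Qed.

Lemma mxtrace_bfgs_update (R : realType) (d : nat) (B : 'M[R]_d)
    (s y : 'cV[R]_d) :
  B^T = B ->
  \tr (bfgs_update B s y) =
  \tr B - dot (B *m s) (B *m s) / dot s (B *m s) + dot y y / dot y s.
Proof.
move=> Bt; have -> : bfgs_update B s y = B - (dot s (B *m s))^-1 *:
    ((B *m s) *m (B *m s)^T) + (dot y s)^-1 *: (y *m y^T).
  by rewrite /bfgs_update trmx_mul Bt !mulmxA.
rewrite mxtraceD raddfB /= !mxtraceZ !mxtrace_mul_tr.
by rewrite ![_^-1 * _]mulrC.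
Qed.

Lemma Psi_bfgs_update (R : realType) (d : nat) (L : R) (B : 'M[R]_d)
    (s y : 'cV[R]_d) :
  0 < L -> spd B -> 0 < dot s (B *m s) -> 0 < dot y s ->
  Psi L (bfgs_update B s y) =
  Psi L B + dot y y / (L * dot y s)
    - dot (B *m s) (B *m s) / (L * dot s (B *m s))
    - ln (dot y s / dot s (B *m s)).
Proof.
move=> L0 Bs q0 ys0; have Li : 0 < L^-1 by rewrite invr_gt0.
(* Positivity of this determinant lets the logarithm of the updated determinant split; the scaling
   by [L^-1] stays attached to [B] throughout. *)
have [dB _] := spd_ln_det_le (spdZ Li Bs).
have -> : Psi L (bfgs_update B s y) =
    L^-1 * (\tr B - dot (B *m s) (B *m s) / dot s (B *m s) + dot y y / dot y s)
    - d%:R - ln (dot y s / dot s (B *m s) * \det (L^-1 *: B)).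
  rewrite /Psi mxtraceZ mxtrace_bfgs_update ?(proj1 Bs) // !detZ.
  by rewrite det_bfgs_update ?(proj1 Bs) // mulrCA.
rewrite lnM ?posrE ?divr_gt0 // /Psi mxtraceZ !invfM; ring.
Qed.

(* r_i depends on B_i only through the angle between s_i and B_i s_i, since
   B_i s_i is a multiple of g_i. *)
Lemma rratio_secant (R : realType) (L a : R) (d : nat) (g b s y : 'cV[R]_d) :
  a != 0 -> b = a *: g ->
  L * dot g s ^+ 2 / (dot g g * dot y s) =
  L * dot s b ^+ 2 / (dot b b * dot y s).
Proof.
move=> a0 ->; rewrite !(dotZl, dotZr) (dotC s).
have -> : L * (a * dot g s) ^+ 2 = (a * a) * (L * dot g s ^+ 2) by ring.
have -> : a * (a * dot g g) * dot y s = (a * a) * (dot g g * dot y s) by ring.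
by rewrite -[RHS]mulf_div divff ?mul1r // mulf_neq0.
Qed.

(** * One step of the method, then the telescoped run *)

Lemma bfgs_step_secant (R : realType) (d : nat) (f : 'cV[R]_d -> R)
    (c1 c2 : R) (x x' : 'cV[R]_d) (B B' : 'M[R]_d) :
  spd B -> c2 < 1 -> bfgs_step f c1 c2 x B x' B' ->
  [/\ grad f x != 0, B' = bfgs_update B (x' - x) (grad f x' - grad f x),
      0 < dot (x' - x) (B *m (x' - x)),
      0 < dot (grad f x' - grad f x) (x' - x) &
      exists2 a : R, a != 0 & B *m (x' - x) = a *: grad f x].
Proof.
move=> Bs c21 [gn0 [al [al0 _ wo x'E ->]]].
have Bu := spd_unitmx Bs; set g := grad f x in gn0 wo x'E *.
have g0 : g != 0.
  by apply: contraNneq gn0 => ->; rewrite /enorm dot0r sqrtr0.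
set p := - (invmx B *m g) in wo x'E.
have sE : x' - x = al *: p by rewrite x'E addrC addKr.
have Bp : B *m p = - g by rewrite mulmxN mulKVmx.
have p0 : p != 0.
  by apply: contraNneq g0 => p0; rewrite -oppr_eq0 -Bp p0 mulmx0.
(* Positive definiteness at [p], with [B *m p = - g], says that [p] is a descent direction. *)
have := proj2 Bs p p0; rewrite Bp dotNr (dotC p) => gp.
split=> //; last 1 first.
- exists (- al); first by rewrite oppr_eq0 gt_eqF.
  by rewrite sE -scalemxAr Bp scalerN scaleNr.
- rewrite sE -scalemxAr Bp dotZl dotZr dotNr (dotC p).
  by rewrite !mulr_gt0.
rewrite sE dotZr mulr_gt0 // dotBl.
(* The Wolfe condition gives [dot (grad f x' - g) p >= (c2 - 1) * dot g p], a product of two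
   negative factors. *)
move: wo; rewrite /wolfe -x'E -/g => wo; nra.
Qed.

Lemma Psi_bfgs_step (R : realType) (d : nat) (f : 'cV[R]_d -> R)
    (L c1 c2 : R) (x : nat -> 'cV[R]_d) (i : nat) (B B' : 'M[R]_d) :
  0 < L -> spd B -> c2 < 1 -> bfgs_step f c1 c2 (x i) B (x i.+1) B' ->
  [/\ spd B', 0 < dot (ydiff f x i) (sdiff x i), 0 < rratio L f x i &
      Psi L B' <= Psi L B + ln (rratio L f x i)
        - (1 - enorm (ydiff f x i) ^+ 2
               / (L * dot (ydiff f x i) (sdiff x i)))].
Proof.
move=> L0 Bs c21 /(bfgs_step_secant Bs c21).
rewrite /rratio -/(sdiff x i) -/(ydiff f x i) !sqr_enorm.
set s := sdiff x i; set y := ydiff f x i.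
move=> [g0 -> q0 ys0 [a a0 BsE]].
rewrite (rratio_secant L s y a0 BsE) Psi_bfgs_update //.
have b0 : 0 < dot (B *m s) (B *m s).
  by rewrite lt_def dot_ge0 andbT dot_eq0 BsE scaler_eq0 negb_or a0.
move: q0 b0 ys0 (bfgs_update_spd Bs q0 ys0).
set q := dot s (B *m s); set b := dot (B *m s) _; set m := dot y s.
move=> q0 b0 m0 Bs'.
have t0 : 0 < b / (L * q) by rewrite divr_gt0 // mulr_gt0.
(* The factor [(m / q)^-1] matches the determinant change exactly; only the other factor is
   estimated, through [ln t <= t - 1]. *)
have -> : L * q ^+ 2 / (b * m) = (b / (L * q))^-1 * (m / q)^-1.
  by field; rewrite !gt_eqF.
have m0q : 0 < m / q by exact: divr_gt0.
split=> //; first by rewrite mulr_gt0 ?invr_gt0.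
rewrite [ln (_^-1 * _)]lnM ?posrE ?invr_gt0 // !lnV ?posrE //.
by have := ln_le_sub1 t0; lra.
Qed.

(** Positive definiteness is carried through the induction: each step requires it of the current
    matrix, and the final bound [0 <= Psi L (B k)] requires it of the last one. *)
Lemma Psi_bfgs_run (R : realType) (d : nat) (f : 'cV[R]_d -> R)
    (L c1 c2 : R) (x0 : 'cV[R]_d) (B0 : 'M[R]_d) (k : nat)
    (x : nat -> 'cV[R]_d) (B : nat -> 'M[R]_d) :
  0 < L -> spd B0 -> c2 < 1 -> bfgs_run f c1 c2 x0 B0 k x B ->
  spd (B k) /\
  Psi L (B k) <= Psi L B0 + \sum_(i < k) ln (rratio L f x i)
    - \sum_(i < k) (1 - enorm (ydiff f x i) ^+ 2
                        / (L * dot (ydiff f x i) (sdiff x i))).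
Proof.
move=> L0 Bs c21 [xE BE step]; elim: k step => [|k IHk] step.
  by rewrite !big_ord0 BE addr0 subr0.
have [Bks le_k] := IHk (fun i ik => step i (ltnW ik)).
have [Bs' _ _ le_step] := Psi_bfgs_step L0 Bks c21 (step k (ltnSn k)).
by split=> //; rewrite !big_ord_recr /=; lra.
Qed.

Unset Implicit Arguments.

Theorem lemma2p2 (R : realType) (d : nat) (f : 'cV[R]_d -> R) (L c1 c2 : R)
  (x0 : 'cV[R]_d) (B0 : 'M[R]_d) (x : nat -> 'cV[R]_d) (B : nat -> 'M[R]_d)
  (k : nat)
  (f_C1 : continuously_differentiable f)
  (f_convex : @convex_function R 'cV[R]_d setT f)
  (L_gt0 : 0 < L)
  (f_lipschitz : gradient_lipschitz L f)
  (B0_spd : spd B0)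
  (c1_gt0 : 0 < c1) (c1_lt_c2 : c1 < c2) (c2_lt1 : c2 < 1)
  (k_ge1 : (1 <= k)%N)
  (run : bfgs_run f c1 c2 x0 B0 k x B)
  (running : before_termination f x k) :
  [/\ \sum_(i < k) ln (rratio L f x i)
        >= - Psi L B0
           + \sum_(i < k) (1 - enorm (ydiff f x i) ^+ 2
                               / (L * dot (ydiff f x i) (sdiff x i))),
      - Psi L B0
           + \sum_(i < k) (1 - enorm (ydiff f x i) ^+ 2
                               / (L * dot (ydiff f x i) (sdiff x i)))
        >= - Psi L B0
    & \prod_(i < k) rratio L f x i >= expR (- Psi L B0)].
Proof.
have [xE BE step] := run.
have [Bks Psi_le] := Psi_bfgs_run L_gt0 B0_spd c2_lt1 run.
have stepi (i : 'I_k) : 0 < dot (ydiff f x i) (sdiff x i) /\ 0 < rratio L f x i.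
  (* A prefix of a run is a run, so every intermediate [B i] is positive definite. *)
  have runi : bfgs_run f c1 c2 x0 B0 i x B.
    by split=> // j ji; apply: step; apply: ltn_trans ji (ltn_ord i).
  have [Bis _] := Psi_bfgs_run L_gt0 B0_spd c2_lt1 runi.
  by have [] := Psi_bfgs_step L_gt0 Bis c2_lt1 (step i (ltn_ord i)).
have Psik := Psi_ge0 L_gt0 Bks.
have tail_ge0 : 0 <= \sum_(i < k) (1 - enorm (ydiff f x i) ^+ 2
                                / (L * dot (ydiff f x i) (sdiff x i))).
  apply: sumr_ge0 => i _; have [ys0 _] := stepi i.
  rewrite subr_ge0 ler_pdivrMr ?mulr_gt0 // mul1r.
  exact: grad_cocoercive (proj1 f_C1) L_gt0 f_lipschitz f_convex.
have ln_sum_ge : - Psi L B0 <= \sum_(i < k) ln (rratio L f x i) by lra.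
split; [lra | lra |].
(* Each ratio is positive, so exponentiating the bound on the sum of logarithms recovers the
   product. *)
have -> : \prod_(i < k) rratio L f x i = expR (\sum_(i < k) ln (rratio L f x i)).
  rewrite expR_sum; apply: eq_bigr => i _.
  by rewrite lnK // posrE; have [] := stepi i.
by rewrite ler_expR.
Qed.
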